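(* Let $k_1,\dots,k_l\ge 1$ be integers, let $n=k_1+\dots+k_l$, and let $H$ be the bipartite graph with $n$ vertices on each side that is the disjoint union of the complete bipartite graphs $K_{k_1,k_1},\dots,K_{k_l,k_l}$. Then $H$ has the highest number of perfect matchings among all bipartite graphs with the same left-vertex degrees: for every bipartite graph $G=(X\cup Y,E)$ with $|X|=|Y|=n$ whose multiset of degrees of vertices in $X$ equals that of the left vertices of $H$ (the value $k_j$ taken $k_j$ times for each $j=1,\dots,l$), one has $\mathcal{M}(G)\le\mathcal{M}(H)$.
   Context: Graphs are simple. A bipartite graph $G=(X\cup Y,E)$ has vertex bipartition $X$ (left) and $Y$ (right) with $|X|=|Y|=n$. A perfect matching is a set of $n$ edges such that every vertex is incident to exactly one of them. $\mathcal{M}(G)$ denotes the number of perfect matchings of $G$. $K_{k,k}$ is the complete bipartite graph with $k$ vertices on each side (a complete bipartite component ''of size $k$''); each component $K_{k_j,k_j}$ contributes $k_j$ vertices to each side. *)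

(* Defs.v *)
From mathcomp Require Import all_boot.
Set Implicit Arguments.
Unset Strict Implicit.
Unset Printing Implicit Defensive.

(* A finite simple bipartite graph with a fixed bipartition: the vertex set is
   the disjoint sum of [left] and [right], and the pair (x, y) stands for the
   undirected edge joining x on the left to y on the right. *)
Record bigraph := Bigraph {
  left : finType;
  right : finType;
  edges : {set left * right} }.

Definition ldeg (G : bigraph) (x : left G) : nat :=
  #|[set e in edges G | e.1 == x]|.

Definition ldegs (G : bigraph) : seq nat := [seq ldeg x | x : left G].

Definition perfect_matching (G : bigraph) (M : {set left G * right G}) : bool :=
  [&& M \subset edges G,
      #|M| == #|left G|,
      [forall x : left G, #|[set e in M | e.1 == x]| == 1] &
      [forall y : right G, #|[set e in M | e.2 == y]| == 1]].

Definition num_perfect_matchings (G : bigraph) : nat :=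
  #|[set M : {set left G * right G} | perfect_matching M]|.

Definition complete_bigraph (m n : nat) : bigraph :=
  @Bigraph 'I_m 'I_n setT.

(* Vertices of the disjoint union are vertices of the G i tagged by i. *)
Definition disjoint_union (I : finType) (G : I -> bigraph) : bigraph :=
  @Bigraph {i : I & left (G i)} {i : I & right (G i)}
    (\bigcup_(i : I)
       [set (Tagged (fun i => left (G i)) e.1, Tagged (fun i => right (G i)) e.2)
          | e in edges (G i)]).

(* Main.v *)
Require Import Defs.
From mathcomp Require Import all_boot.
From mathcomp Require Import order ssralg ssrnum rat perm.

(* The degree sequence of H turns Bregman's bound
   M(G) <= \prod_x (d_x)!^(1/d_x) into \prod_j (k_j)! = M(H).
   Bregman's bound is proved by Schrijver's induction on n: the weighted AM-GM
   inequality along each row bounds P^(n P), where P = M(G), by a product over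
   all perfect matchings s of \prod_i d_i P_(i,s(i)), with P_(i,k) the number
   of perfect matchings through the edge (i,k); the induction hypothesis for
   the minors bounds P_(i,k), and for fixed s the factors recombine exactly
   into \prod_j (d_j)!^(n/d_j).  Raising everything to a power L divisible by
   all the degrees keeps the argument inside the natural numbers. *)

Set Implicit Arguments.
Unset Strict Implicit.
Import GRing.Theory Num.Theory.

(* AM-GM for the numbers 1 / |fiber of s|, whose sum over A is #|h @: A|. *)
Lemma leq_card_fibers (S T : finType) (A : {set S}) (h : S -> T) :
  #|A| ^ #|A| <=
    #|h @: A| ^ #|A| * \prod_(s in A) #|[set t in A | h t == h s]|.
Proof.
pose c s := #|[set t in A | h t == h s]|.
have c_gt0 s : s \in A -> 0 < c s.
  by move=> sA; apply/card_gt0P; exists s; rewrite inE sA /=.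
have c_neq0 s : s \in A -> ((c s)%:R != 0 :> rat)%R.
  by move=> sA; rewrite pnatr_eq0 -lt0n c_gt0.
pose E s : rat := ((c s)%:R^-1)%R.
have E_ge0 : {in A, forall s, (0 <= E s *+ #|A|)%R}.
  by move=> s _; rewrite mulrn_wge0 // invr_ge0 ler0n.
(* A fiber with [m] elements contributes [m] terms [1 / m], hence 1. *)
have sumE : (\sum_(s in A) E s = #|h @: A|%:R)%R.
  rewrite (partition_big_imset h) /= -sum1_card natr_sum.
  apply: eq_bigr => y /imsetP[s sA ->].
  rewrite (eq_bigr (fun=> E s)) => [|t /andP[_ /eqP hts]]; last first.
    by rewrite /E /c hts.
  rewrite sumr_const -[#|_|]/#|[pred t | (t \in A) && (h t == h s)]|.
  have -> : #|[pred t | (t \in A) && (h t == h s)]| = c s.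
    by apply: eq_card => t; rewrite !inE.
  by rewrite -[LHS]mulr_natl mulfV ?c_neq0.
have := (leif_AGM_scaled E_ge0).1; rewrite sumE => AGM.
rewrite -(ler_nat rat).
have -> : ((#|A| ^ #|A|)%:R = \prod_(s in A) (E s *+ #|A|) *
    (\prod_(s in A) c s)%:R :> rat)%R.
  rewrite natr_prod -big_split /= natrX -prodr_const.
  by apply: eq_bigr => s sA; rewrite mulrnAl mulVf ?c_neq0.
by rewrite natrM natrX ler_wpM2r ?ler0n.
Qed.

(** * Permanents of 0-1 matrices *)

(** Its cardinal is the permanent of the 0-1 matrix [e]. *)
Definition admissible n (e : rel 'I_n) : {set 'S_n} :=
  [set s : 'S_n | [forall i, e i (s i)]].

Definition minor n (e : rel 'I_n.+1) (i k : 'I_n.+1) : rel 'I_n :=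
  fun x y => e (lift i x) (lift k y).

(** Deleting row [i] and column [k] from such an [s] leaves an admissible permutation of the minor,
    from which [lift_perm i k] rebuilds [s]. *)
Lemma card_admissible_minor n (e : rel 'I_n.+1) i k :
  #|[set s in admissible e | s i == k]| <= #|admissible (minor e i k)|.
Proof.
apply: leq_trans (leq_imset_card (lift_perm i k) _).
apply/subset_leq_card/subsetP=> s; rewrite !inE => /andP[/forallP adm_s /eqP sik].
have s_lift x : exists y, s (lift i x) = lift k y.
  have : k != s (lift i x) by rewrite -sik (inj_eq perm_inj) neq_lift.
  by case/unlift_some=> y -> _; exists y.
have [t st] := fin_all_exists s_lift.
have t_inj : injective t.
  move=> x y txy; apply: (@lift_inj _ i); apply: (@perm_inj _ s).
  by rewrite !st txy.
apply/imsetP; exists (perm t_inj).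
  by rewrite inE; apply/forallP=> x; rewrite permE /minor -st.
apply/permP=> j; case: (unliftP i j) => [x|] ->.
  by rewrite lift_perm_lift permE st.
by rewrite lift_perm_id sik.
Qed.

Lemma card_minor_row n (e : rel 'I_n.+1) i k x :
  #|minor e i k x| = #|e (lift i x)| - e (lift i x) k.
Proof.
have -> : #|e (lift i x)| = \sum_y (e (lift i x) y : nat).
  by rewrite -sum1_card big_mkcond.
rewrite (bigD1_ord k) //= addKn -sum1_card big_mkcond /=.
exact: eq_bigr.
Qed.

(* The integer r!^(L/r), for r dividing L; the junk value at r = 0 is 1. *)
Definition fact_root L r := r`! ^ (L %/ r).

Lemma expn_fact_root L r : r %| L -> fact_root L r ^ r = r`! ^ L.
Proof. by move=> rL; rewrite -expnM divnK. Qed.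

(** This is the exact recombination of the factors of one row with [r] ones, [k0] being the column
    chosen by the matching. The other [r - 1] ones together give [(r-1)!^L], which [r ^ L] completes
    to [r!^L], that is, [r] factors [fact_root L r]; each of the [n - r] zeros gives one more. *)
Lemma prod_fact_root_row L n (a : pred 'I_n) k0 :
  (forall r, 0 < r <= n -> r %| L) -> a k0 ->
  #|a| ^ L * \prod_(k | k != k0) fact_root L (#|a| - a k) =
    fact_root L #|a| ^ n.
Proof.
move=> Ldvd ak0; set r := #|a|.
have r_le : r <= n by rewrite -[leqRHS]card_ord max_card.
have r_gt0 : 0 < r by apply/card_gt0P; exists k0.
have rS : r = #|[pred k | (k != k0) && a k]|.+1.
  rewrite /r (cardD1 k0) [k0 \in a]ak0 add1n; congr _.+1.
rewrite (bigID a) /=.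
rewrite (eq_bigr (fun=> fact_root L r.-1)); last first.
  by move=> k /andP[_ ->]; rewrite subn1.
rewrite [X in _ * (_ * X)](eq_bigr (fun=> fact_root L r)); last first.
  by move=> k /andP[_ /negPf->]; rewrite subn0.
rewrite !prod_nat_const -[#|_|]/#|[pred k | (k != k0) && a k]|.
have -> : #|[pred k | (k != k0) && a k]| = r.-1 by rewrite rS.
have -> : #|[pred k | (k != k0) && ~~ a k]| = n - r.
  rewrite -[in RHS](card_ord n) -(cardC a) addKn; apply: eq_card => k.
  by rewrite !inE andb_idl //; apply: contraNneq => ->.
rewrite mulnA.
have -> : #|a| ^ L * fact_root L r.-1 ^ r.-1 = fact_root L r ^ r.
  have -> : fact_root L r.-1 ^ r.-1 = r.-1`! ^ L.
    (* For [r = 1] the divisibility hypothesis says nothing about [r - 1], but both sides are 1. *)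
    have [->|r1_gt0] := posnP r.-1; first by rewrite fact0 exp1n.
    by rewrite expn_fact_root ?Ldvd // r1_gt0 (leq_trans (leq_pred r)).
  rewrite expn_fact_root ?Ldvd ?r_gt0 // -expnMn -/r.
  by rewrite -[in LHS](prednK r_gt0) -factS prednK.
by rewrite -expnD subnKC.
Qed.

Lemma expn_prod (I : Type) (r : seq I) (P : pred I) (F : I -> nat) m :
  (\prod_(i <- r | P i) F i) ^ m = \prod_(i <- r | P i) F i ^ m.
Proof. by apply: (big_morph (expn^~ m) _ (exp1n m)) => x y; apply: expnMn. Qed.

Lemma bregman_permanent L n (e : rel 'I_n) :
  0 < L -> (forall r, 0 < r <= n -> r %| L) ->
  #|admissible e| ^ L <= \prod_i fact_root L #|e i|.
Proof.
move=> L_gt0; elim: n e => [|n IHn] e Ldvd.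
  rewrite big_ord0 -[leqRHS](exp1n L) leq_exp2r // -[leqRHS](card_Sn 0).
  exact: max_card.
set P := #|admissible e|; set T := \prod_i _.
have [->|P_gt0] := posnP P; first by rewrite exp0n.
pose c (s : 'S_n.+1) i := #|[set t in admissible e | t i == s i]|.
(* AM-GM is applied to the fibers of [s |-> s i], whose values all lie in row [i]. *)
have row_le i : P ^ P <= \prod_(s in admissible e) (#|e i| * c s i).
  rewrite big_split /= prod_nat_const.
  apply: leq_trans (leq_card_fibers _ (fun s : 'S_n.+1 => s i)) _.
  rewrite leq_mul2r leq_exp2r //; apply/orP; right.
  apply/subset_leq_card/subsetP=> k /imsetP[s]; rewrite inE => /forallP adm_s ->.
  exact: adm_s.
have perm_le s : s \in admissible e -> \prod_i (#|e i| * c s i) ^ L <= T ^ n.+1.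
  rewrite inE => /forallP adm_s.
  have minor_le i :
      c s i ^ L <= \prod_(j | j != i) fact_root L (#|e j| - e j (s i)).
    apply: (@leq_trans (#|admissible (minor e i (s i))| ^ L)).
      by rewrite leq_exp2r // card_admissible_minor.
    apply: leq_trans (IHn _ _) _ => [r /andP[r_gt0 r_le]|].
      by rewrite Ldvd // r_gt0 ltnW.
    under eq_bigr => x _ do rewrite card_minor_row.
    rewrite [leqRHS]big_mkcond (bigD1_ord i) //= eqxx mul1n.
    by apply: leq_prod => x _; rewrite eq_sym neq_lift.
  rewrite (eq_bigr _ (fun i _ => expnMn _ _ _)) big_split /=.
  apply: (@leq_trans (\prod_i #|e i| ^ L *
      \prod_i \prod_(j | j != i) fact_root L (#|e j| - e j (s i)))).
    by rewrite leq_mul2l leq_prod ?orbT.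
  (* Regrouped by row [j], the columns [s i] with [i != j] run over all columns except [s j]. *)
  rewrite (exchange_big_dep predT) //= -big_split /= expn_prod.
  apply: leq_prod => j _.
  rewrite -(prod_fact_root_row Ldvd (adm_s j)).
  rewrite [X in _ <= _ * X](reindex_inj (@perm_inj _ s)) /=.
  by under eq_bigl => i do rewrite eq_sym -(inj_eq (@perm_inj _ s)).
(* In the exponent, [n.+1] comes from multiplying [row_le] over all rows, and [P] from multiplying
   [perm_le] over all admissible [s]. *)
have NP_gt0 : 0 < n.+1 * P by rewrite muln_gt0.
rewrite -(leq_exp2r _ _ NP_gt0).
have -> : (P ^ L) ^ (n.+1 * P) = (\prod_(i < n.+1) P ^ P) ^ L.
  by rewrite prod_nat_const card_ord -!expnM mulnC (mulnC n.+1) -mulnA.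
apply: (@leq_trans ((\prod_i \prod_(s in admissible e) (#|e i| * c s i)) ^ L)).
  by rewrite leq_exp2r // leq_prod.
rewrite exchange_big /= expn_prod expnM -(prod_nat_const (mem (admissible e))).
by apply: leq_prod => s adm_s; rewrite expn_prod perm_le.
Qed.

(** * From permanents to perfect matchings *)

Lemma ldegE (G : bigraph) (x : left G) :
  ldeg x = #|[pred y | (x, y) \in edges G]|.
Proof.
have pair_inj : injective (@pair (left G) (right G) x) by move=> y z [].
rewrite -(card_imset _ pair_inj); apply: eq_card => -[x' y]; rewrite !inE /=.
apply/andP/imsetP => [[xyG /eqP <-]|[z zG [-> ->]]]; last by [].
by exists y.
Qed.

Lemma ord_bij (T : finType) n : #|T| = n -> exists b : 'I_n -> T, bijective b.
Proof. by move=> <-; exists enum_val; apply: enum_val_bij. Qed.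

Lemma bregman_bigraph (G : bigraph) L n :
  #|left G| = n -> #|right G| = n ->
  0 < L -> (forall r, 0 < r <= n -> r %| L) ->
  num_perfect_matchings G ^ L <= \prod_(d <- ldegs G) fact_root L d.
Proof.
move=> /ord_bij[b b_bij] /ord_bij[c c_bij] L_gt0 Ldvd.
pose e : rel 'I_n := fun i j => (b i, c j) \in edges G.
have degE i : ldeg (b i) = #|e i|.
  rewrite ldegE -!sum1_card (reindex c) //=; exact: onW_bij.
have -> : \prod_(d <- ldegs G) fact_root L d = \prod_i fact_root L #|e i|.
  rewrite /ldegs big_image /= (reindex b) /=; last exact: onW_bij.
  by apply: eq_bigr => i _; rewrite degE.
apply: leq_trans (bregman_permanent e L_gt0 Ldvd); rewrite leq_exp2r //.
(* Once both sides are numbered, every perfect matching is the graph of an admissible permutation,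
   which bounds their number. *)
pose graph (s : 'S_n) := [set (b i, c (s i)) | i : 'I_n].
apply: leq_trans (leq_imset_card graph _).
apply/subset_leq_card/subsetP=> M; rewrite inE.
case/and4P=> MG _ /forallP Ml /forallP Mr.
have Ml_ex i : exists j, (b i, c j) \in M.
  have /cards1P[[x y] Mx] := Ml (b i).
  have : (x, y) \in [set e in M | e.1 == b i] by rewrite Mx set11.
  rewrite inE /= => /andP[xyM /eqP <-]; have [c' _ c'K] := c_bij.
  by exists (c' y); rewrite c'K.
have [s sM] := fin_all_exists Ml_ex.
have s_inj : injective s.
  move=> i j sij; have /cards1P[p Mp] := Mr (c (s i)).
  have : (b i, c (s i)) \in [set e in M | e.2 == c (s i)].
    by rewrite inE sM /=.
  have : (b j, c (s j)) \in [set e in M | e.2 == c (s i)].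
    by rewrite inE sM /= sij.
  by rewrite Mp !inE => /eqP <- /eqP[/(bij_inj b_bij)].
apply/imsetP; exists (perm s_inj).
  by rewrite inE; apply/forallP=> i; rewrite permE /e (subsetP MG) ?sM.
apply/setP=> -[x y]; apply/idP/imsetP=> [xyM|[i _ ->]]; last by rewrite permE.
have [b' _ b'K] := b_bij; exists (b' x) => //; rewrite permE b'K.
have /cards1P[p Mp] := Ml x.
have : (x, y) \in [set e in M | e.1 == x] by rewrite inE xyM /=.
have : (x, c (s (b' x))) \in [set e in M | e.1 == x].
  by rewrite inE /= eqxx andbT -{1}[x]b'K.
by rewrite Mp !inE => /eqP -> /eqP.
Qed.

Lemma bij_perfect_matching (G : bigraph) (f : left G -> right G) :
  bijective f -> (forall x, (x, f x) \in edges G) ->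
  perfect_matching [set (x, f x) | x : left G].
Proof.
move=> [g fK gK] fG; apply/and4P; split.
- by apply/subsetP=> _ /imsetP[x _ ->].
- by rewrite card_imset // => x y [].
- apply/forallP=> x; apply/cards1P; exists (x, f x).
  apply/setP=> -[x' y]; rewrite !inE.
  apply/andP/eqP => /= [[/imsetP[z _ [-> ->]] /eqP->]|[-> ->]] //.
  by rewrite eqxx imset_f.
- apply/forallP=> y; apply/cards1P; exists (g y, y).
  apply/setP=> -[x y']; rewrite !inE.
  apply/andP/eqP => /= [[/imsetP[z _ [-> ->]] /eqP<-]|[-> ->]] //.
    by rewrite fK.
  by rewrite eqxx -{2}[y]gK imset_f.
Qed.

(** * Degrees and matchings of the extremal graph *)

Section DisjointUnion.
Variables (I : finType) (k : I -> nat).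
Let H := disjoint_union (fun j => complete_bigraph (k j) (k j)).

Lemma ldeg_disjoint_union_complete (x : left H) : ldeg x = k (tag x).
Proof.
(* Neighbours are the right vertices with the same tag; [&& true] gives the filter the shape that
   [sig_big_dep] splits by component. *)
rewrite ldegE -sum1_card (eq_bigl (fun y => (tag y == tag x) && true)).
  rewrite -(sig_big_dep (pred1 (tag x)) (fun=> xpredT) (fun _ _ => 1)) /=.
  by rewrite big_pred1_eq sum1_card card_ord.
case: x => j i [j' i']; rewrite andbT inE /=.
apply/bigcupP/eqP => [[j0 _ /imsetP[p _ xy]]|jj'].
  exact: etrans (congr1 (fun u => tag u.2) xy)
    (esym (congr1 (fun u => tag u.1) xy)).
move: i'; rewrite /= jj' => i'; exists j => //.
by apply/imsetP; exists (i, i'); rewrite ?inE.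
Qed.

(** Choosing one permutation per component yields distinct perfect matchings; this lower bound is
    what Bregman's upper bound for [G] gets compared with. *)
Lemma prod_fact_leq_num_perfect_matchings :
  \prod_j (k j)`! <= num_perfect_matchings H.
Proof.
pose f (p : {dffun forall j, 'S_(k j)}) (x : left H) : right H :=
  Tagged (fun j => 'I_(k j)) (p (tag x) (tagged x)).
have -> : \prod_j (k j)`! = #|{dffun forall j, 'S_(k j)}|.
  rewrite card_dep_ffun foldrE big_image /=.
  by apply: eq_bigr => j _; rewrite card_Sn.
pose graph p := [set (x, f p x) | x : left H].
have graph_inj : injective graph.
  move=> p q pq; apply/ffunP=> j; apply/permP=> i.
  pose x : left H := Tagged (fun j => 'I_(k j)) i.
  have : (x, f p x) \in graph q by rewrite -pq imset_f.
  case/imsetP=> y _ xy; move: (congr1 snd xy).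
  rewrite -(congr1 fst xy : x = y) => /eqP.
  by rewrite /f /= eq_Tagged => /eqP.
rewrite -cardsT -(card_imset _ graph_inj).
apply/subset_leq_card/subsetP=> _ /imsetP[p _ ->]; rewrite inE.
apply: bij_perfect_matching => [|[j i]].
  exists (fun x => Tagged (fun j => 'I_(k j)) ((p (tag x))^-1%g (tagged x)));
    case=> j i.
    by rewrite /f /= permK.
  by rewrite /f /= permKV.
by apply/bigcupP; exists j => //; apply/imsetP; exists (i, p j i).
Qed.
End DisjointUnion.

Theorem lemma2 (l : nat) (k : 'I_l -> nat) (hk : forall j : 'I_l, 1 <= k j)
    (n : nat) (hn : n = \sum_(j < l) k j)
    (H : bigraph)
    (hH : H = disjoint_union (fun j : 'I_l => complete_bigraph (k j) (k j)))
    (G : bigraph) (hX : #|left G| = n) (hY : #|right G| = n)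
    (hdeg : perm_eq (ldegs G) (ldegs H)) :
  num_perfect_matchings G <= num_perfect_matchings H.
Proof.
(* The exponent is [L = n!], a common multiple of all possible nonzero degrees. *)
have L_gt0 := fact_gt0 n.
have Ldvd r : 0 < r <= n -> r %| n`! by move=> rn; rewrite dvdn_fact.
apply: leq_trans (_ : \prod_j (k j)`! <= _); last first.
  by rewrite hH prod_fact_leq_num_perfect_matchings.
rewrite -(leq_exp2r _ _ L_gt0).
apply: leq_trans (bregman_bigraph hX hY L_gt0 Ldvd) _.
rewrite (perm_big _ hdeg) hH /ldegs big_image /= expn_prod.
under eq_bigr => x _ do rewrite ldeg_disjoint_union_complete.
(* Component [j] supplies [k j] equal factors, whose product is exactly the [L]-th power of
   [(k j)!]. *)
rewrite -(sig_big_dep xpredT (fun j => xpredT) (fun j _ => fact_root n`! (k j))) /=.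
apply: leq_prod => j _; rewrite prod_nat_const card_ord expn_fact_root //.
by rewrite Ldvd // hk hn (bigD1 j) //= leq_addr.
Qed.
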